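(* Let $(X,\|\cdot\|)$ be a Banach space, $C\subseteq X$ a closed convex set, and $T:C\to C$ a nonexpansive map. Let $(\alpha_n)_{n\ge 1}$ be a sequence in $[0,1]$, $(e_n)_{n\ge 1}$ a sequence in $X$ (with the convention $e_0=0$), $x_0\in C$, and let $(x_n)_{n\in\mathbb{N}}$ be generated by $$x_{n+1}=(1-\alpha_{n+1})\,x_n+\alpha_{n+1}\,(Tx_n+e_{n+1}),\qquad n\in\mathbb{N}.$$ Assume that there exists $\kappa\in[0,\infty)$ such that $x_n\in C$ and $\|Tx_n-x_0\|\le\kappa$ for all $n\in\mathbb{N}$. Suppose that $\sum_{k\ge1}\|e_k\|<\infty$ and that $\alpha_n$ is bounded away from $0$ and $1$. Then there exists a constant $\nu\ge0$ such that, for all $n\ge1$, $$\|x_n-Tx_n\|\le\frac{\nu}{\sqrt n}+\sum_{i\ge\lfloor n/2\rfloor}2\|e_i\|.$$ Moreover, if $\varphi:[0,\infty)\to[0,\infty)$ is nondecreasing and $\mu=\sum_{k\ge1}\varphi(k)\|e_k\|<\infty$, then (with the same $\nu$) $$\|x_n-Tx_n\|\le\frac{\nu}{\sqrt n}+\frac{2\mu}{\varphi(\lfloor n/2\rfloor)}.$$ In particular, if $\sum_{k\ge1}k^a\|e_k\|<\infty$ for some $a\ge0$, then $\|x_n-Tx_n\|=O(1/n^b)$ with $b=\min\{\tfrac12,a\}$.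
   Context: $\mathbb{N}=\{0,1,2,\dots\}$. $T$ nonexpansive means $\|Tx-Ty\|\le\|x-y\|$ for all $x,y$ in its domain. ''Bounded away from $0$ and $1$'' means there is $\delta>0$ with $\delta\le\alpha_n\le1-\delta$ for all $n\ge1$. $\lfloor\cdot\rfloor$ denotes the integer part. *)

(* Defs.v *)
From HB Require Import structures.
From mathcomp Require Import all_boot all_order all_algebra.
From mathcomp Require Import all_classical all_reals all_analysis.

Set Implicit Arguments.
Unset Strict Implicit.
Unset Printing Implicit Defensive.

Import Order.TTheory GRing.Theory Num.Theory.
Import numFieldNormedType.Exports.

Local Open Scope classical_set_scope.
Local Open Scope ring_scope.

Definition nonexpansive_on (R : realType) (X : normedModType R) (C : set X)
    (T : X -> X) : Prop :=
  {in C &, forall x y, `|T x - T y| <= `|x - y|}.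

(* The inexact Krasnoselskii-Mann iteration; [alpha 0] is never used. *)
Definition inexact_KM (R : realType) (X : normedModType R) (T : X -> X)
    (alpha : nat -> R) (e x : nat -> X) : Prop :=
  forall n, x n.+1 =
    (1 - alpha n.+1) *: x n + alpha n.+1 *: (T (x n) + e n.+1).

Definition bounded_away_from_0_1 (R : realType) (alpha : nat -> R) : Prop :=
  exists2 delta : R, 0 < delta &
    forall n, (1 <= n)%N -> delta <= alpha n <= 1 - delta.

(* Main.v *)
Require Import Defs.
From HB Require Import structures.
From mathcomp Require Import all_boot all_order all_algebra.
From mathcomp Require Import all_classical all_reals all_analysis.
From mathcomp Require Import ring lra zify.

Set Implicit Arguments.
Unset Strict Implicit.
Unset Printing Implicit Defensive.

Import Order.TTheory GRing.Theory Num.Theory.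
Import numFieldNormedType.Exports.

Local Open Scope classical_set_scope.
Local Open Scope ring_scope.

(** Why the theorem holds.

    Fix n and put m = n./2.  Let y be the error-free iteration, with the same
    relaxation coefficients, started at y_0 = x_m.  Since T is nonexpansive,
    each step of the iteration increases the distance between the two
    sequences by at most the norm of the error, so that
    |x_(m+k) - y_k| <= \sum_(m < i <= m+k) |e_i|
    (inexact_KM_orbit_dist).  Hence |x_n - T x_n| exceeds the residual of y at
    time n - m by at most twice the tail of the error series beyond m, and it
    remains to bound the residual of an error-free iteration after
    k = n - m >= n/2 steps by a constant multiple of 1 / sqrt k, uniformly in
    m.

    For the error-free iteration, |y_n - y_m| and |T y_n - y_m| with m <= n are
    bounded by a double recursion: unfolding y_n in the first quantity, or y_m
    in the second one, gives a convex combination of both quantities at smaller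
    indices.  This recursion has a probabilistic solution.  Let F_i and H_i be
    independent Bernoulli variables of parameter alpha_i, for i >= 1, and
    consider the lazy symmetric random walk whose steps are F_i - H_i, read
    from i = n down to i = 1.  Then |T y_n - y_n| is at most
    K = sup_k |T y_k - y_0| times the probability that this walk, started at
    0, never becomes negative (KM_orbit_residual_le).

    The walk makes each of the moves 1 and -1 with probability
    alpha_i (1 - alpha_i) >= delta^2, so it leaves an interval of length L in a
    time of order L^2, and does so through the upper end with probability about
    1 / L.  An explicit supersolution, linear in time and quadratic in space
    (survival_le), turns this into a survival probability of order
    1 / L + L / N over N steps, that is 1 / sqrt N for L close to sqrt N
    (survival_rate).

    The weighted bounds follow from the comparison
    \sum_(i > m) |e_i| <= mu / phi m (weighted_tail_le), applied to
    phi t = t `^ a for the last claim. *)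

(** * Survival probabilities of a lazy symmetric walk *)

(** [survival alpha n z] is the probability that the walk with steps F_i - H_i,
    i = n, ..., 1, where F_i and H_i are independent Bernoulli variables of
    parameter [alpha i], started at height [z], always stays positive.  Heights
    are shifted by one: the absorbing state is [0] instead of [-1], so that
    they can be natural numbers. *)
Fixpoint survival (R : realType) (alpha : nat -> R) (n z : nat) : R :=
  match n, z with
  | _, 0 => 0
  | 0, _ => 1
  | m.+1, k.+1 =>
      let w := survival alpha m in
      (1 - alpha m.+1) * ((1 - alpha m.+1) * w k.+1 + alpha m.+1 * w k.+2)
      + alpha m.+1 * ((1 - alpha m.+1) * w k + alpha m.+1 * w k.+1)
  end.

(** [bernoulli_mean alpha m d f z] is the mean of [f (z + B)], where [B] is the
    sum of the Bernoulli variables of parameters [alpha i], m < i <= m + d.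
    The recursion conditions on the variable of the largest index. *)
Fixpoint bernoulli_mean (R : realType) (alpha : nat -> R) (m d : nat)
    (f : nat -> R) (z : nat) : R :=
  if d is k.+1 then
    (1 - alpha (m + k).+1) * bernoulli_mean alpha m k f z
    + alpha (m + k).+1 * bernoulli_mean alpha m k f z.+1
  else f z.

Lemma eq_bernoulli_mean (R : realType) (alpha : nat -> R) m d
    (f g : nat -> R) z :
  (forall k, (z <= k)%N -> f k = g k) ->
  bernoulli_mean alpha m d f z = bernoulli_mean alpha m d g z.
Proof.
elim: d z => [|d IH] z fg /=; first exact: fg.
by rewrite !IH// => k /ltnW; apply: fg.
Qed.

(** Conditioning on the variable of the smallest index. *)
Lemma bernoulli_mean_split (R : realType) (alpha : nat -> R) m d
    (f : nat -> R) z :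
  bernoulli_mean alpha m d.+1 f z =
  bernoulli_mean alpha m.+1 d
    (fun k => (1 - alpha m.+1) * f k + alpha m.+1 * f k.+1) z.
Proof.
elim: d z => [|d IH] z; first by rewrite /= addn0.
transitivity ((1 - alpha (m.+1 + d).+1) * bernoulli_mean alpha m d.+1 f z
  + alpha (m.+1 + d).+1 * bernoulli_mean alpha m d.+1 f z.+1).
  by rewrite addSnnS.
by rewrite !IH.
Qed.

Lemma bernoulli_mean_comb (R : realType) (alpha : nat -> R) m d
    (f g : nat -> R) (a b : R) z :
  bernoulli_mean alpha m d (fun k => a * f k + b * g k) z =
  a * bernoulli_mean alpha m d f z + b * bernoulli_mean alpha m d g z.
Proof. elim: d z => [//|d IH] z /=; rewrite !IH; ring. Qed.

Lemma bernoulli_mean_shift (R : realType) (alpha : nat -> R) m d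
    (f : nat -> R) z :
  bernoulli_mean alpha m d f z.+1 =
  bernoulli_mean alpha m d (fun k => f k.+1) z.
Proof. by elim: d z => [//|d IH] z /=; rewrite !IH. Qed.

(** The recursion satisfied by the bound on |T y_n - y_m|, with
    n = m + 1 + d: conditioning on H_(m+1) either leaves the height unchanged or
    lowers it by one, while F_(m+1) joins the variables that are averaged. *)
Lemma survival_mean_step (R : realType) (alpha : nat -> R) m d :
  bernoulli_mean alpha m.+1 d (survival alpha m.+1) 1 =
  (1 - alpha m.+1) * bernoulli_mean alpha m d.+1 (survival alpha m) 1
  + alpha m.+1 * bernoulli_mean alpha m d.+1 (survival alpha m) 0.
Proof.
rewrite !bernoulli_mean_split !bernoulli_mean_shift -bernoulli_mean_comb.
exact: eq_bernoulli_mean.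
Qed.

Lemma survival_itv (R : realType) (alpha : nat -> R)
    (alpha01 : forall n, (1 <= n)%N -> 0 <= alpha n <= 1) n z :
  0 <= survival alpha n z <= 1.
Proof.
elim: n z => [|n IH] [|z]; rewrite /= ?lexx ?ler01//.
have /andP[a0 a1] := alpha01 n.+1 isT.
have /andP[? ?] := IH z; have /andP[? ?] := IH z.+1.
have /andP[? ?] := IH z.+2.
set a := alpha n.+1 in a0 a1 *.
have comb u v : 0 <= u <= 1 -> 0 <= v <= 1 -> 0 <= (1 - a) * u + a * v <= 1.
  by move=> /andP[? ?] /andP[? ?]; apply/andP; split; nra.
by apply: (comb); apply: (comb).
Qed.

(** The right-hand side, divided by N L, is
    z / L + (z (L - z) / (2 p) + N - n) / N: the probability of leaving [0, L]
    through L, plus a Markov bound on the probability of not leaving it in N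
    steps.  It is a supersolution of the recursion for [survival], because one
    step lowers the mean of z (L - z) by at least 2 p; it is at least 1 where
    n = 0, and where z = L. *)
Lemma survival_le (R : realType) (alpha : nat -> R) (p : R) (L N : nat)
    (alpha01 : forall n, (1 <= n)%N -> 0 <= alpha n <= 1)
    (p_gt0 : 0 < p)
    (p_le : forall n, (1 <= n)%N -> p <= alpha n * (1 - alpha n)) n z :
  (n <= N)%N -> (z <= L)%N ->
  survival alpha n z * (N%:R * L%:R) <=
    z%:R * N%:R +
    (z%:R * (L%:R - z%:R) / (2 * p) + (N%:R - n%:R)) * L%:R.
Proof.
elim: n z => [|n IH] z nN zL.
  have N0 : 0 <= N%:R :> R := ler0n _ _.
  have L0 : 0 <= L%:R :> R := ler0n _ _.
  have z0 : 0 <= z%:R :> R := ler0n _ _.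
  have zL' : 0 <= L%:R - z%:R :> R by rewrite subr_ge0 ler_nat.
  have w1 : survival alpha 0 z <= 1.
    by have /andP[] := survival_itv alpha01 0 z.
  have q0 : 0 <= z%:R * (L%:R - z%:R) / (2 * p) * L%:R.
    by rewrite !mulr_ge0// ?invr_ge0 ?mulr_ge0// ltW.
  have : survival alpha 0 z * (N%:R * L%:R) <= 1 * (N%:R * L%:R).
    by rewrite ler_wpM2r// mulr_ge0.
  have : 0 <= z%:R * N%:R :> R by rewrite mulr_ge0.
  by rewrite mulrDl; lra.
have NnR : n%:R + 1 <= N%:R :> R by rewrite natr1 ler_nat.
have L0 : 0 <= L%:R :> R := ler0n _ _.
case: z zL => [|z] zL.
  rewrite /= !mul0r !add0r -natr1.
  by apply: mulr_ge0 => //; lra.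
move: zL; rewrite leq_eqVlt => /predU1P[zL|zL].
  rewrite zL subrr mulr0 mul0r add0r -natr1.
  have /andP[_ w1] := survival_itv alpha01 n.+1 L.
  have : survival alpha n.+1 L * (N%:R * L%:R) <= 1 * (N%:R * L%:R).
    by rewrite ler_wpM2r// mulr_ge0.
  have : 0 <= (N%:R - (n%:R + 1)) * L%:R :> R by apply: mulr_ge0 => //; lra.
  by lra.
have I0 := IH z (ltnW nN) (ltnW (ltnW zL)).
have I1 := IH z.+1 (ltnW nN) (ltnW zL).
have I2 := IH z.+2 (ltnW nN) zL.
have /andP[a0 a1] := alpha01 n.+1 isT; have pa := p_le n.+1 isT.
rewrite /=; move: I0 I1 I2 a0 a1 pa.
move: (alpha n.+1) (survival alpha n z) (survival alpha n z.+1)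
  (survival alpha n z.+2).
(* [w0], [w1], [w2] are the survival probabilities at the three heights that
   can be reached; the products by N and L are kept to avoid divisions. *)
move=> a w0 w1 w2; rewrite -![_.+2%:R]natr1 -![z.+1%:R]natr1 -![n.+1%:R]natr1.
move: (z%:R : R) (n%:R : R) (N%:R : R) (L%:R : R) L0 => x m M l L0.
move=> I0 I1 I2 a0 a1 pa.
set q := (2 * p)^-1 in I0 I1 I2 *.
have qp : 2 * p * q = 1 by rewrite mulfV// mulf_neq0 ?gt_eqF.
have q0 : 0 <= q by rewrite invr_ge0 mulr_ge0// ltW.
set V0 := (X in _ <= X) in I0; set V1 := (X in _ <= X) in I1.
set V2 := (X in _ <= X) in I2.
have b0 : 0 <= a * (1 - a) by apply: le_trans pa; apply: ltW.
have c0 : 0 <= 1 - 2 * (a * (1 - a)).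
  by have := sqr_ge0 (1 - 2 * a); rewrite expr2; lra.
set b := a * (1 - a) in pa b0 c0 *.
have -> : ((1 - a) * ((1 - a) * w1 + a * w2)
      + a * ((1 - a) * w0 + a * w1)) * (M * l) =
  b * (w0 * (M * l)) + (1 - 2 * b) * (w1 * (M * l)) + b * (w2 * (M * l)).
  by rewrite /b; ring.
apply: (@le_trans _ _ (b * V0 + (1 - 2 * b) * V1 + b * V2)).
  by rewrite !lerD// ler_wpM2l.
rewrite -subr_ge0.
have -> : (x + 1) * M + ((x + 1) * (l - (x + 1)) * q + (M - (m + 1))) * l -
   (b * V0 + (1 - 2 * b) * V1 + b * V2) = (2 * b * q - 1) * l.
  by rewrite /V0 /V1 /V2; ring.
apply: mulr_ge0 => //; rewrite subr_ge0.
apply: (@le_trans _ _ (2 * p * q)); first by rewrite qp.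
by rewrite ler_wpM2r// ler_wpM2l.
Qed.

(** * The error-free iteration *)

Lemma convex_set_comb (R : realType) (X : normedModType R) (C : set X)
    (C_convex : convex_set C) (t : R) (x y : X) :
  0 <= t <= 1 -> C x -> C y -> C ((1 - t) *: x + t *: y).
Proof.
move=> /andP[t0 t1] Cx Cy.
have := C_convex y x (Itv01 t0 t1); rewrite !inE => /(_ Cy Cx).
by rewrite addrC.
Qed.

(** The Krasnoselskii-Mann iteration without errors, started at [y0];
    [alpha 0] is never used. *)
Fixpoint KM_orbit (R : realType) (X : normedModType R) (T : X -> X)
    (alpha : nat -> R) (y0 : X) (n : nat) : X :=
  if n is k.+1 then
    (1 - alpha k.+1) *: KM_orbit T alpha y0 k
    + alpha k.+1 *: T (KM_orbit T alpha y0 k)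
  else y0.

Lemma normr_comb_le (R : realType) (X : normedModType R) (a : R) (u v : X) :
  0 <= a <= 1 -> `|(1 - a) *: u + a *: v| <= (1 - a) * `|u| + a * `|v|.
Proof.
move=> /andP[a0 a1]; apply: le_trans (ler_normD _ _) _.
by rewrite !normrZ !ger0_norm// subr_ge0.
Qed.

Lemma comb_subr (R : realType) (X : normedModType R) (a : R) (u v w : X) :
  (1 - a) *: u + a *: v - w = (1 - a) *: (u - w) + a *: (v - w).
Proof.
by rewrite !scalerBr addrACA -opprD -scalerDl subrK scale1r.
Qed.

Section ExactIteration.
Variables (R : realType) (X : normedModType R) (C : set X) (T : X -> X).
Variables (alpha : nat -> R) (y0 : X).
Hypothesis C_convex : convex_set C.
Hypothesis TC : set_fun C C T.
Hypothesis T_nonexp : nonexpansive_on C T.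
Hypothesis alpha01 : forall n, (1 <= n)%N -> 0 <= alpha n <= 1.
Hypothesis Cy0 : C y0.

Let y := KM_orbit T alpha y0.

Lemma KM_orbit_in n : C (y n).
Proof.
elim: n => [//|n IH].
by apply: convex_set_comb => //; [exact: alpha01|exact: TC].
Qed.

Variable K : R.
Hypothesis Ty_bnd : forall n, `|T (y n) - y0| <= K.

(** The walk bounds both kinds of distances.  They are proved together: the
    second one at m + 1 uses both at m, and the first one at n + 1 uses both at
    n.  Before the addition of the variables F_i, m < i <= n, the walk has
    shifted height 0 for y_n - y_m, and 1 for T y_n - y_m. *)
Lemma KM_orbit_dist_le m d :
  `|y (m + d) - y m| <= K * bernoulli_mean alpha m d (survival alpha m) 0 /\
  `|T (y (m + d)) - y m| <= K * bernoulli_mean alpha m d (survival alpha m) 1.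
Proof.
elim: m d => [|m IHm] d.
  have v1 k z : bernoulli_mean alpha 0 k (survival alpha 0) z.+1 = 1.
    by elim: k z => [//|k IH] z /=; rewrite !IH; ring.
  split; last by rewrite v1 mulr1; apply: Ty_bnd.
  elim: d => [|d IHd]; first by rewrite subrr normr0 mulr0.
  rewrite addnS /= comb_subr -/y.
  apply: le_trans (normr_comb_le _ _ (alpha01 _)) _ => //.
  have /andP[a0 a1] := alpha01 (ltn0Sn (0 + d)).
  rewrite mulrDr mulrCA [K * (alpha _ * _)]mulrCA v1 mulr1.
  by rewrite lerD// ler_wpM2l ?subr_ge0//; apply: Ty_bnd.
have v k : `|T (y (m.+1 + k)) - y m.+1| <=
    K * bernoulli_mean alpha m.+1 k (survival alpha m.+1) 1.
  have [uI vI] := IHm k.+1; rewrite -addSnnS in uI vI.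
  rewrite survival_mean_step distrC /= comb_subr -/y.
  apply: le_trans (normr_comb_le _ _ (alpha01 _)) _ => //.
  have /andP[a0 a1] := alpha01 (ltn0Sn m).
  rewrite mulrDr mulrCA [K * (alpha _ * _)]mulrCA.
  rewrite lerD// ler_wpM2l ?subr_ge0//.
    by rewrite distrC.
  rewrite -/y in uI vI *.
  apply: le_trans uI; rewrite [leRHS]distrC.
  by apply: T_nonexp; rewrite inE; apply: KM_orbit_in.
split; last exact: v.
elim: d => [|d IHd]; first by rewrite addn0 subrr normr0 mulr0.
rewrite addnS [y (_).+1]/= comb_subr -/y.
apply: le_trans (normr_comb_le _ _ (alpha01 _)) _ => //.
have /andP[a0 a1] := alpha01 (ltn0Sn (m.+1 + d)).
rewrite [bernoulli_mean _ _ _ _ _]/= mulrDr mulrCA [K * (alpha _ * _)]mulrCA.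
by rewrite lerD// ler_wpM2l ?subr_ge0.
Qed.

Lemma KM_orbit_residual_le n : `|T (y n) - y n| <= K * survival alpha n 1.
Proof. by have [_] := KM_orbit_dist_le n 0; rewrite addn0. Qed.

End ExactIteration.

(** The level L in [survival_le] is the integer part of the square root
    of n. *)
Lemma survival_rate (R : realType) (alpha : nat -> R) (delta : R)
    (delta_gt0 : 0 < delta)
    (alpha_delta : forall n, (1 <= n)%N -> delta <= alpha n <= 1 - delta) n :
  (1 <= n)%N ->
  survival alpha n 1 <= (2 + (2 * delta ^+ 2)^-1) / Num.sqrt n%:R.
Proof.
move=> n0.
have alpha01 k : (1 <= k)%N -> 0 <= alpha k <= 1.
  by move=> /alpha_delta /andP[? ?]; apply/andP; split; lra.
set s := Num.sqrt n%:R; set L := Num.trunc s; set q := (_ * _)^-1.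
have s1 : 1 <= s by rewrite -[leLHS]sqrtr1 ler_wsqrtr// ler1n.
have s0 : 0 < s by apply: lt_le_trans s1.
have ss : s * s = n%:R by rewrite -expr2 sqr_sqrtr.
have /andP[Ls sL] := truncn_itv (ltW s0).
have L1 : 1 <= L%:R :> R by rewrite ler1n truncn_gt0.
rewrite -/L -natr1 in Ls sL.
have q0 : 0 <= q by rewrite invr_ge0 mulr_ge0 ?sqr_ge0.
have p0 : 0 < delta ^+ 2 by rewrite exprn_gt0.
have pa k : (1 <= k)%N -> delta ^+ 2 <= alpha k * (1 - alpha k).
  move=> /alpha_delta /andP[? ?]; rewrite expr2.
  by apply: ler_pM; lra.
have := @survival_le _ alpha _ L n alpha01 p0 pa n 1 (leqnn n).
rewrite -(ler_nat R) => /(_ L1); rewrite -/q subrr addr0 !mul1r -ss.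
set w := survival _ _ _ => wle.
rewrite ler_pdivlMr// -(@ler_pM2r _ (s * L%:R)); last by nra.
have -> : w * s * (s * L%:R) = w * (s * s * L%:R) by ring.
apply: le_trans wle _.
have e1 : s * s <= 2 * (s * L%:R) by nra.
have e2 : (L%:R - 1) * L%:R <= s * L%:R by nra.
have : (L%:R - 1) * L%:R * q <= s * L%:R * q by rewrite ler_wpM2r.
lra.
Qed.

(** The residual of the error-free iteration is O(1 / sqrt n), with a constant
    that depends only on [K] and [delta]. *)
Lemma KM_residual_rate (R : realType) (X : normedModType R) (C : set X)
    (T : X -> X) (alpha : nat -> R) (y0 : X) (delta K : R)
    (C_convex : convex_set C) (TC : set_fun C C T)
    (T_nonexp : nonexpansive_on C T) (Cy0 : C y0)
    (delta_gt0 : 0 < delta)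
    (alpha_delta : forall n, (1 <= n)%N -> delta <= alpha n <= 1 - delta)
    (Ty_bnd : forall n, `|T (KM_orbit T alpha y0 n) - y0| <= K) n :
  (1 <= n)%N ->
  `|KM_orbit T alpha y0 n - T (KM_orbit T alpha y0 n)| <=
    K * ((2 + (2 * delta ^+ 2)^-1) / Num.sqrt n%:R).
Proof.
move=> n1; rewrite distrC.
have alpha01 k : (1 <= k)%N -> 0 <= alpha k <= 1.
  by move=> /alpha_delta /andP[? ?]; apply/andP; split; lra.
apply: le_trans (KM_orbit_residual_le C_convex TC T_nonexp alpha01 Cy0 Ty_bnd n) _.
rewrite ler_wpM2l ?(le_trans (normr_ge0 _) (Ty_bnd 0%N))//.
exact: (survival_rate delta_gt0 alpha_delta).
Qed.

(** * The inexact iteration *)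

Section InexactIteration.
Variables (R : realType) (X : normedModType R) (C : set X) (T : X -> X).
Variables (alpha : nat -> R) (e x : nat -> X).
Hypothesis C_convex : convex_set C.
Hypothesis TC : set_fun C C T.
Hypothesis T_nonexp : nonexpansive_on C T.
Hypothesis alpha01 : forall n, (1 <= n)%N -> 0 <= alpha n <= 1.
Hypothesis x_rec : inexact_KM T alpha e x.
Hypothesis Cx : forall n, C (x n).

Lemma inexact_KM_orbit_dist m k :
  `|x (m + k) - KM_orbit T (fun i => alpha (m + i)) (x m) k| <=
    \sum_(m.+1 <= i < (m + k).+1) `|e i|.
Proof.
have alpha01m i : (1 <= i)%N -> 0 <= alpha (m + i) <= 1.
  by move=> i1; apply: alpha01; rewrite (leq_trans i1)// leq_addl.
elim: k => [|k IH]; first by rewrite addn0 subrr normr0 big_geq.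
rewrite addnS x_rec big_nat_recr/= ?ltnS ?leq_addr// addnS.
have /andP[a0 a1] := alpha01 (ltn0Sn (m + k)).
set y := KM_orbit _ _ _ _ in IH *; set a := alpha _ in a0 a1 *.
have -> : (1 - a) *: x (m + k) + a *: (T (x (m + k)) + e (m + k).+1) -
    ((1 - a) *: y + a *: T y) =
    ((1 - a) *: (x (m + k) - y) + a *: (T (x (m + k)) - T y))
    + a *: e (m + k).+1.
  rewrite scalerDr addrA addrAC opprD addrACA !scalerBr.
  by rewrite [X in X + _ = _]addrAC [LHS]addrAC.
apply: le_trans (ler_normD _ _) _; apply: lerD.
  apply: le_trans (normr_comb_le _ _ _) _; first by rewrite a0 a1.
  have Txy : `|T (x (m + k)) - T y| <= `|x (m + k) - y|.
    by apply: T_nonexp; rewrite inE//; apply: KM_orbit_in.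
  have := ler_wpM2l a0 Txy; lra.
by rewrite normrZ ger0_norm// ler_piMl.
Qed.

Variable kappa : R.
Hypothesis Tx_bnd : forall n, `|T (x n) - x 0%N| <= kappa.

Lemma inexact_KM_bounded n :
  `|x n - x 0%N| <= kappa + \sum_(1 <= i < n.+1) `|e i|.
Proof.
have kappa0 : 0 <= kappa by apply: le_trans (normr_ge0 _) (Tx_bnd 0).
elim: n => [|n IH]; first by rewrite subrr normr0 big_geq// addr0.
rewrite x_rec big_nat_recr//= comb_subr.
have a01 := alpha01 (ltn0Sn n); have /andP[a0 a1] := a01.
rewrite [T _ + _ - _]addrAC [alpha _ *: _]scalerDr addrA.
apply: le_trans (ler_normD _ _) _; rewrite addrA; apply: lerD.
  apply: le_trans (normr_comb_le _ _ a01) _.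
  have e0 : 0 <= \sum_(1 <= i < n.+1) `|e i| by apply: sumr_ge0.
  set S := \sum_(_ <= _ < _) _ in IH e0 *; set a := alpha _ in a0 a1 *.
  have b0 : 0 <= 1 - a by rewrite subr_ge0.
  have := ler_wpM2l a0 (Tx_bnd n); have := ler_wpM2l b0 IH.
  have := mulr_ge0 a0 e0; lra.
by rewrite normrZ ger0_norm// ler_piMl.
Qed.

Variables (delta S : R).
Hypothesis delta_gt0 : 0 < delta.
Hypothesis alpha_delta :
  forall n, (1 <= n)%N -> delta <= alpha n <= 1 - delta.
Hypothesis e_bnd : forall n, \sum_(1 <= i < n.+1) `|e i| <= S.

(** The error-free iteration restarted at x_m satisfies the boundedness
    hypothesis of [KM_residual_rate] with a constant independent of [m]. *)
Lemma inexact_KM_residual_le m k : (1 <= k)%N ->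
  `|x (m + k) - T (x (m + k))| <=
    2 * (kappa + S) * ((2 + (2 * delta ^+ 2)^-1) / Num.sqrt k%:R)
    + 2 * \sum_(m.+1 <= i < (m + k).+1) `|e i|.
Proof.
move=> k1; set am := fun i => alpha (m + i).
have am_delta i : (1 <= i)%N -> delta <= am i <= 1 - delta.
  by move=> i1; apply: alpha_delta; rewrite (leq_trans i1)// leq_addl.
have am01 i : (1 <= i)%N -> 0 <= am i <= 1.
  by move=> i1; apply: alpha01; rewrite (leq_trans i1)// leq_addl.
pose y := KM_orbit T am (x m).
have Cy i : C (y i) by apply: KM_orbit_in.
have Txy i : `|T (x (m + i)) - T (y i)| <=
    \sum_(m.+1 <= j < (m + i).+1) `|e j|.
  apply: le_trans (inexact_KM_orbit_dist m i).
  by apply: T_nonexp; rewrite inE.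
have tail i : \sum_(m.+1 <= j < (m + i).+1) `|e j| <= S.
  apply: le_trans (e_bnd (m + i)).
  by rewrite [leRHS](@big_cat_nat _ _ _ m.+1)//= ?ltnS ?leq_addr// lerDr sumr_ge0.
have Ty_bnd i : `|T (y i) - x m| <= 2 * (kappa + S).
  have -> : T (y i) - x m = (T (y i) - T (x (m + i))) +
      ((T (x (m + i)) - x 0%N) + (x 0%N - x m)) by rewrite addrA !subrKA.
  apply: le_trans (ler_normD _ _) _.
  have := ler_normD (T (x (m + i)) - x 0%N) (x 0%N - x m).
  rewrite [`|T (y i) - _|]distrC [`|x 0%N - _|]distrC.
  have := Txy i; have := tail i; have := Tx_bnd (m + i).
  have := inexact_KM_bounded m; have := e_bnd m; lra.
have := KM_residual_rate C_convex TC T_nonexp (Cx m) delta_gt0 am_delta Ty_bnd k1.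
rewrite -/(y k); have := Txy k; have := inexact_KM_orbit_dist m k.
rewrite -/am -/(y k).
have -> : x (m + k) - T (x (m + k)) = (x (m + k) - y k) +
    ((y k - T (y k)) - (T (x (m + k)) - T (y k))).
  by rewrite opprB addrA !subrKA.
have := ler_normD (x (m + k) - y k) ((y k - T (y k)) - (T (x (m + k)) - T (y k))).
have := ler_normB (y k - T (y k)) (T (x (m + k)) - T (y k)).
lra.
Qed.

Lemma inexact_KM_half_rate : exists2 nu : R, 0 <= nu &
  forall n, (1 <= n)%N -> `|x n - T (x n)| <=
    nu / Num.sqrt n%:R + 2 * \sum_(n./2.+1 <= i < n.+1) `|e i|.
Proof.
pose c := 2 * (kappa + S) * (2 + (2 * delta ^+ 2)^-1).
have c0 : 0 <= c.
  rewrite mulr_ge0// ?mulr_ge0// ?addr_ge0//.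
  - by apply: le_trans (normr_ge0 _) (Tx_bnd 0).
  - by have := e_bnd 0; rewrite big_geq.
  - by rewrite invr_ge0 mulr_ge0// exprn_ge0// ltW.
(* The factor 2 absorbs the passage from sqrt (uphalf n) to sqrt n. *)
exists (2 * c) => [|n n1]; first by rewrite mulr_ge0.
have nE : (n./2 + uphalf n = n)%N.
  by rewrite uphalf_half addnCA addnn odd_double_half.
have k1 : (1 <= uphalf n)%N by case: n n1 {nE}.
have := inexact_KM_residual_le n./2 k1; rewrite nE.
move=> /le_trans; apply; rewrite lerD2r mulrA -/c.
have s0 i : (1 <= i)%N -> 0 < Num.sqrt i%:R :> R by rewrite sqrtr_gt0 ltr0n.
rewrite [2 * c]mulrC -[leRHS]mulrA ler_wpM2l//.
rewrite ler_pdivlMr ?s0// mulrC ler_pdivrMr ?s0//.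
rewrite -(ler_pXn2r (_ : 0 < 2)%N) ?nnegrE ?mulr_ge0 ?sqrtr_ge0//.
rewrite exprMn !sqr_sqrtr// -natrX -natrM ler_nat.
by rewrite -{1}nE; have := uphalf_half n; lia.
Qed.

End InexactIteration.

(** * Tails of weighted series *)

Lemma nneseries_partial_le (R : realType) (a : nat -> R) (s : R) (m n : nat) :
  (forall i, (m <= i)%N -> 0 <= a i) ->
  (\sum_(m <= i <oo) (a i)%:E <= s%:E)%E -> \sum_(m <= i < n) a i <= s.
Proof.
move=> a0 as_; rewrite -lee_fin -sumEFin; apply: le_trans as_.
by apply: nneseries_lim_ge => i mi _; rewrite lee_fin a0.
Qed.

Lemma weighted_tail_le (R : realType) (a h : nat -> R) (mu : R) (m n : nat) :
  (forall i, 0 <= a i) -> (forall i, 0 <= h i) ->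
  {homo h : i j / (i <= j)%N >-> i <= j} -> 0 < h m ->
  (\sum_(1 <= i <oo) (h i * a i)%:E <= mu%:E)%E ->
  \sum_(m.+1 <= i < n.+1) a i <= mu / h m.
Proof.
move=> a0 h0 h_homo hm hmu; rewrite ler_pdivlMr// mulrC big_distrr/=.
have ha0 i : (1 <= i)%N -> 0 <= h i * a i by move=> _; rewrite mulr_ge0.
have [mn|nm] := leqP m n; last first.
  rewrite big_geq; last exact: ltnW.
  by have := nneseries_partial_le 1 ha0 hmu; rewrite big_geq.
apply: (@le_trans _ _ (\sum_(1 <= i < n.+1) h i * a i)); last first.
  exact: nneseries_partial_le.
rewrite [leRHS](@big_cat_nat _ _ _ m.+1)//=.
apply: ler_wpDl; first by apply: sumr_ge0 => i _; rewrite mulr_ge0.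
rewrite big_nat_cond [leRHS]big_nat_cond; apply: ler_sum => i /andP[/andP[mi _] _].
by rewrite ler_wpM2r// h_homo// ltnW.
Qed.

Lemma powR_half_ge (R : realType) (a : R) (n : nat) : 0 <= a -> (2 <= n)%N ->
  n%:R `^ a <= 3 `^ a * n./2%:R `^ a.
Proof.
move=> a0 n2; rewrite -powRM//.
apply: ge0_ler_powR; rewrite ?nnegrE ?mulr_ge0//.
rewrite -natrM ler_nat; have := odd_double_half n; lia.
Qed.

Theorem theorem3p1 (R : realType) (X : completeNormedModType R)
    (C : set X) (T : X -> X) (alpha : nat -> R) (e x : nat -> X) (kappa : R)
    (C_closed : closed C)
    (C_convex : convex_set C)
    (TC : set_fun C C T)
    (T_nonexp : nonexpansive_on C T)
    (alpha01 : forall n, (1 <= n)%N -> 0 <= alpha n <= 1)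
    (e0 : e 0%N = 0)
    (x0C : C (x 0%N))
    (x_rec : inexact_KM T alpha e x)
    (kappa_ge0 : 0 <= kappa)
    (x_bnd : forall n, C (x n) /\ `|T (x n) - x 0%N| <= kappa)
    (e_summable : (\sum_(1 <= k <oo) `|e k|%:E < +oo)%E)
    (alpha_away : bounded_away_from_0_1 alpha) :
  (exists2 nu : R, 0 <= nu &
    (forall n, (1 <= n)%N ->
       (`|x n - T (x n)|%:E <=
          (nu / Num.sqrt n%:R)%:E + \sum_(n./2 <= i <oo) (2 * `|e i|)%:E)%E) /\
    (forall (phi : R -> R) (mu : R),
       (forall t, 0 <= t -> 0 <= phi t) ->
       {in `[0, +oo[ &, {homo phi : s t / s <= t}} ->
       (mu%:E = \sum_(1 <= k <oo) (phi k%:R * `|e k|)%:E)%E ->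
       forall n, (1 <= n)%N -> 0 < phi (n./2)%:R ->
         `|x n - T (x n)| <= nu / Num.sqrt n%:R + 2 * mu / phi (n./2)%:R)) /\
  (forall a : R, 0 <= a ->
     (\sum_(1 <= k <oo) (k%:R `^ a * `|e k|)%:E < +oo)%E ->
     (fun n => `|x n - T (x n)|) =O_\oo
       (fun n => (n%:R `^ Num.min 2^-1 a)^-1 : R)).
Proof.
have Cx n : C (x n) by have [] := x_bnd n.
have Tx_bnd n : `|T (x n) - x 0%N| <= kappa by have [] := x_bnd n.
have [delta delta_gt0 alpha_delta] := alpha_away.
have fin_sum (h : nat -> R) : (forall i, 0 <= h i) ->
    (\sum_(1 <= k <oo) (h k)%:E < +oo)%E ->
    (\sum_(1 <= k <oo) (h k)%:E <= (fine (\sum_(1 <= k <oo) (h k)%:E))%:E)%E.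
  move=> h0 hoo; rewrite fineK// ge0_fin_numE//.
  by apply: nneseries_ge0 => i _ _; rewrite lee_fin.
have e_bnd n : \sum_(1 <= i < n.+1) `|e i| <=
    fine (\sum_(1 <= k <oo) `|e k|%:E)%E.
  by apply: nneseries_partial_le => //; apply: fin_sum.
have [nu nu0 rate] := inexact_KM_half_rate C_convex TC T_nonexp alpha01 x_rec
  Cx Tx_bnd delta_gt0 alpha_delta e_bnd.
split.
  exists nu => //; split => [n n1|phi mu phi0 phi_homo muE n n1 phin].
    have /le_trans : (`|x n - T (x n)|%:E <= (nu / Num.sqrt n%:R
        + 2 * \sum_(n./2.+1 <= i < n.+1) `|e i|)%:E)%E by rewrite lee_fin rate.
    apply; rewrite EFinD leeD2l// big_distrr/= -sumEFin.
    apply: (@le_trans _ _ (\sum_(n./2 <= i < n.+1) (2 * `|e i|)%:E)%E).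
      rewrite [leRHS]big_ltn ?leeDr ?lee_fin ?mulr_ge0//; lia.
    by apply: nneseries_lim_ge => i _ _; rewrite lee_fin mulr_ge0.
  apply: le_trans (rate n n1) _; rewrite lerD2l -mulrA ler_wpM2l//.
  apply: (@weighted_tail_le _ (fun i => `|e i|) (fun i => phi i%:R)) => //.
  - by move=> i; apply: phi0.
  - by move=> i j ij; apply: phi_homo; rewrite ?in_itv/= ?ler0n ?ler_nat.
  - by rewrite muE.
move=> a a0 suma.
set h := fun k : nat => k%:R `^ a * `|e k| : R.
have h0 i : 0 <= h i by rewrite mulr_ge0 ?powR_ge0.
have mule := fin_sum h h0 suma.
set mu := fine _ in mule.
have mu0 : 0 <= mu.
  by have := nneseries_partial_le 1 (fun i _ => h0 i) mule; rewrite big_geq.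
(* The summand 1 only serves to make the constant positive. *)
apply/eqO_exP; exists (nu + 2 * mu * 3 `^ a + 1).
  by rewrite ltr_wpDl// addr_ge0// !mulr_ge0 ?powR_ge0.
(* For n >= 2, n./2 is positive, and at least n / 3. *)
exists 2 => // n /= n2.
have n1 : (1 <= n)%N by apply: ltnW.
have nR1 : 1 <= n%:R :> R by rewrite ler1n.
have nR0 : 0 < n%:R :> R by rewrite ltr0n.
have hn0 : 0 < n./2%:R `^ a :> R.
  by apply: powR_gt0; rewrite ltr0n half_gt0.
rewrite normr_id ger0_norm ?invr_ge0 ?powR_ge0//.
set b := Num.min _ _; set pb := _ `^ b.
have pb0 : 0 < pb by apply: powR_gt0.
have pb_s : pb <= Num.sqrt n%:R.
  by rewrite -powR12_sqrt ?ler0n// ler_powR// ge_min lexx.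
have pb_a : pb <= n%:R `^ a by rewrite ler_powR// ge_min lexx orbT.
have r1 : nu / Num.sqrt n%:R <= nu / pb.
  by rewrite ler_wpM2l// lef_pV2 ?posrE// (lt_le_trans pb0).
have tail : \sum_(n./2.+1 <= i < n.+1) `|e i| <= mu / n./2%:R `^ a.
  apply: (@weighted_tail_le _ (fun i => `|e i|) (fun i => i%:R `^ a)) => //.
  by move=> i j ij; apply: ge0_ler_powR; rewrite ?nnegrE ?ler_nat.
have r2 : mu / n./2%:R `^ a <= mu * 3 `^ a / pb.
  rewrite -mulrA ler_wpM2l// ler_pdivlMr// mulrC ler_pdivrMr//.
  by apply: le_trans pb_a _; apply: powR_half_ge.
have := rate n n1; have : 0 <= pb^-1 by rewrite invr_ge0 ltW.
lra.
Qed.
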